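(* For any graph $H$ and any positive integer $t$, the following problem is solvable in polynomial time: given a $P_t$-free graph $G$, decide whether $H$ is an induced minor of $G$.
   Context: All graphs are finite, simple and undirected. A graph $H$ is an induced minor of $G$ if $H$ can be obtained from $G$ by deleting vertices and contracting edges. $P_t$ denotes the path on $t$ vertices, and a graph is $P_t$-free if it contains no induced subgraph isomorphic to $P_t$. The graph $H$ and the integer $t$ are fixed; polynomial time is measured in the size of $G$. *)

(* Defs.v *)
From HB Require Import structures.
From mathcomp Require Import all_boot all_order all_algebra.
Set Implicit Arguments.
Unset Strict Implicit.
Unset Printing Implicit Defensive.

(** * Finite simple graphs *)

Record sgraph := SGraph {
  vertex :> finType;
  adj : rel vertex;
  adj_sym : symmetric adj;
  adj_irrefl : irreflexive adj
}.

Arguments adj {s} x y : rename.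

Definition giso (G H : sgraph) : Prop :=
  exists f : G -> H, bijective f /\ forall x y : G, adj (f x) (f y) = adj x y.

Section Operations.
Variable G : sgraph.

Section Induced.
Variable P : pred G.

Definition induced_adj : rel {x : G | P x} := fun x y => adj (val x) (val y).

Lemma induced_adj_sym : symmetric induced_adj.
Proof. by move=> x y; apply: adj_sym. Qed.

Lemma induced_adj_irrefl : irreflexive induced_adj.
Proof. by move=> x; apply: adj_irrefl. Qed.

Definition induced : sgraph := SGraph induced_adj_sym induced_adj_irrefl.
End Induced.

Definition delete (v : G) : sgraph := induced (fun x => x != v).

(* Contraction of the edge uv: v is removed and u stands for the merged vertex,
   adjacent to every other vertex that was adjacent to u or to v. *)
Section Contract.
Variables u v : G.

Definition contract_adj : rel {x : G | x != v} := fun x y =>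
  (x != y) && [|| adj (val x) (val y),
                  (val x == u) && adj v (val y)
                | (val y == u) && adj v (val x)].

Lemma contract_adj_sym : symmetric contract_adj.
Proof.
move=> x y; rewrite /contract_adj eq_sym adj_sym; congr (_ && (_ || _)).
by rewrite orbC.
Qed.

Lemma contract_adj_irrefl : irreflexive contract_adj.
Proof. by move=> x; rewrite /contract_adj eqxx. Qed.

Definition contract : sgraph := SGraph contract_adj_sym contract_adj_irrefl.
End Contract.

End Operations.

Inductive induced_minor (H : sgraph) : sgraph -> Prop :=
| IMiso (G : sgraph) : giso G H -> induced_minor H G
| IMdelete (G : sgraph) (v : G) :
    induced_minor H (delete v) -> induced_minor H G
| IMcontract (G : sgraph) (u v : G) :
    adj u v -> induced_minor H (contract u v) -> induced_minor H G.

Definition path_adj (t : nat) : rel 'I_t :=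
  fun i j => (i.+1 == j :> nat) || (j.+1 == i :> nat).

Lemma path_adj_sym t : symmetric (@path_adj t).
Proof. by move=> i j; rewrite /path_adj orbC. Qed.

Lemma path_adj_irrefl t : irreflexive (@path_adj t).
Proof. by move=> i; rewrite /path_adj orbb eqn_leq ltnn. Qed.

Definition path_graph (t : nat) : sgraph :=
  SGraph (@path_adj_sym t) (@path_adj_irrefl t).

Definition path_free (t : nat) (G : sgraph) : Prop :=
  forall S : {set G}, ~ giso (induced (fun x => x \in S)) (path_graph t).

(** * Polynomial time on deterministic multi-tape Turing machines *)

Inductive move := MoveL | MoveN | MoveR.

(* The tapes are two-way infinite.  A cell holds [None] (blank), an input bit
   [Some (inl b)] or an auxiliary symbol [Some (inr a)].  A state [q] is
   halting when [tm_out q = Some b], and [b] is then the answer. *)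
Record tm := TM {
  tm_tapes : nat;
  tm_aux : finType;
  tm_state : finType;
  tm_start : tm_state;
  tm_out : tm_state -> option bool;
  tm_trans : tm_state -> {ffun 'I_tm_tapes.+1 -> option (bool + tm_aux)} ->
    tm_state * {ffun 'I_tm_tapes.+1 -> option (bool + tm_aux) * move}
}.

(* [(l, r)]: [l] lists the cells strictly to the left of the head, nearest
   first; [r] lists the scanned cell and those to its right.  All cells beyond
   the two lists are blank. *)
Definition tape (A : Type) : Type := (seq (option A) * seq (option A))%type.

Definition tape_read A (tp : tape A) : option A := head None tp.2.

Definition tape_act A (tp : tape A) (a : option A * move) : tape A :=
  let: (l, r) := tp in
  let: (c, m) := a in
  match m with
  | MoveL => (behead l, head None l :: c :: behead r)
  | MoveN => (l, c :: behead r)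
  | MoveR => (c :: l, behead r)
  end.

Section Run.
Variable M : tm.

Definition tm_config : Type :=
  (tm_state M * {ffun 'I_(tm_tapes M).+1 -> tape (bool + tm_aux M)})%type.

Definition tm_init (w : seq bool) : tm_config :=
  (tm_start M,
   [ffun i => ([::], if i == ord0 then [seq Some (inl b) | b <- w] else [::])]).

Definition tm_step (c : tm_config) : tm_config :=
  if tm_out c.1 is Some _ then c
  else let: (q, a) := tm_trans c.1 [ffun i => tape_read (c.2 i)] in
       (q, [ffun i => tape_act (c.2 i) (a i)]).

(* Halting configurations are fixed by [tm_step], so this is [Some b] exactly
   when [M] halts on [w] with answer [b] after at most [n] steps. *)
Definition tm_answer (w : seq bool) (n : nat) : option bool :=
  tm_out (iter n tm_step (tm_init w)).1.
End Run.

(* The decision problem "given [x] satisfying [promise], does [question x]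
   hold?", with [x] presented to the machine as the word [enc x]. *)
Definition ptime_solvable (X : Type) (enc : X -> seq bool)
    (promise question : X -> Prop) : Prop :=
  exists (M : tm) (p : {poly nat}), forall x : X, promise x ->
    exists b : bool,
      tm_answer M (enc x) (p.[size (enc x)])%R = Some b /\
      (b = true <-> question x).

(* The number of vertices in unary, a separator, and the adjacency matrix row
   by row. *)
Definition graph_code (G : sgraph) : seq bool :=
  nseq #|G| true ++ false :: [seq adj x y | x <- enum G, y <- enum G].

(* Main.v *)
(** [H] is an induced minor of [G] iff [G] contains pairwise disjoint connected
    branch sets, one per vertex of [H], two of which touch iff the corresponding
    vertices of [H] are adjacent.  If [G] is [P_t]-free, the branch set of [h]
    may be replaced by the union of shortest paths, taken inside it, from a root
    to one contact vertex per neighbour of [h]; such a path is induced, hence has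
    fewer than [t] vertices.  The branch sets are thus the values of a tuple of
    vertices of [G] whose length depends on [H] and [t] only, and whether a tuple
    is good depends only on which of its entries are adjacent and which are
    equal.  A three-tape machine tries all tuples. *)
Require Import Defs.
From HB Require Import structures.
From mathcomp Require Import all_boot all_order all_algebra.
From mathcomp Require Import zify.

Set Implicit Arguments.
Unset Strict Implicit.
Unset Printing Implicit Defensive.

(** On the machine side the obstacle is addressing: looking up a matrix entry at given coordinates
    would need arithmetic. No entry is ever looked up. The length [k] of the tuple being fixed, the
    table of all adjacencies and equalities among its entries has finitely many values and fits in
    the state. One sweep of the matrix fills this table, while two copies of the tuple, stored as
    sets of indices along a row of [n] vertex cells, tell which indices own the current row and
    column. A sweep is linear in the input length, and the tuples are run through like the values of
    a [k]-digit counter in base [n]. On the graph side, equality enters beside adjacency because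
    paths of different lengths have to fill the same number of slots: a shorter path is padded by
    repeating its last vertex, and two slots of a branch set count as linked when their vertices are
    adjacent or equal. *)

Lemma connect_hom (T T' : finType) (e : rel T) (e' : rel T') (g : T -> T') :
  (forall x y, e x y -> connect e' (g x) (g y)) ->
  forall x y, connect e x y -> connect e' (g x) (g y).
Proof.
move=> ge x y /connectP [p pth ->]; elim: p x pth => //= z p IH x /andP [xz pth].
exact: connect_trans (ge _ _ xz) (IH _ pth).
Qed.

(** * Induced minor models *)

Section Models.
Variable H : sgraph.

Definition class_rel (G : sgraph) (f : G -> option H) (h : H) : rel G :=
  fun x y => [&& adj x y, f x == Some h & f y == Some h].

(* The branch set of [h] is [f^-1 (Some h)]; vertices sent to [None] are
   deleted. *)
Record model (G : sgraph) (f : G -> option H) : Prop := Model {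
  model_onto : forall h, exists x, f x = Some h;
  model_conn : forall h x y, f x = Some h -> f y = Some h ->
    connect (class_rel f h) x y;
  model_adj : forall h h', h != h' ->
    (adj h h' <-> exists x y, [/\ f x = Some h, f y = Some h' & adj x y])
}.

Lemma class_rel_sym (G : sgraph) (f : G -> option H) h :
  symmetric (class_rel f h).
Proof. by move=> x y; rewrite /class_rel adj_sym; congr (_ && _); rewrite andbC. Qed.

(** Labels are pulled back through each operation: a deleted vertex gets [None], and the vertex
    absorbed by a contraction gets the label of the one that absorbs it. *)
Lemma induced_minor_model (G : sgraph) :
  induced_minor H G -> exists f : G -> option H, model f.
Proof.
elim=> {G} [G [g [[g' gK g'K] adj_g]]|G v _ [f [onto conn fadj]]|G u v uv _ [f [onto conn fadj]]].
- exists (fun x => Some (g x)); split.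
  + by move=> h; exists (g' h); rewrite g'K.
  + by move=> h x y [<-] [/(can_inj gK) ->].
  + move=> h h' hh'; split=> [hadj|[x [y [[<-] [<-]]]]]; last by rewrite adj_g.
    by exists (g' h), (g' h'); rewrite !g'K -adj_g !g'K.
- pose F x : option H := if insub x is Some y then f y else None.
  have Fval (y : delete v) : F (val y) = f y by rewrite /F valK.
  have FSome x h : F x = Some h -> exists2 y : delete v, val y = x & f y = Some h.
    by rewrite /F; case: insubP => // y _ <- fy; exists y.
  exists F; split.
  + by move=> h; have [x fx] := onto h; exists (val x); rewrite Fval.
  + move=> h x y /FSome [x' <- fx'] /FSome [y' <- fy'].
    apply: (connect_hom _ (conn h _ _ fx' fy')) => a b ab; apply: connect1.
    by rewrite /class_rel !Fval.
  + move=> h h' hh'; split.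
      case/fadj=> // x [y [fx fy xy]].
      by exists (val x), (val y); rewrite !Fval.
    case=> x [y [/FSome [x' <- fx] /FSome [y' <- fy] xy]].
    by apply/fadj => //; exists x', y'.
- have uNv : u != v by apply: contraTneq uv => ->; rewrite adj_irrefl.
  pose u' : contract u v := Sub u uNv.
  pose F x : option H := if insub x is Some y then f y else f u'.
  have Fval (y : contract u v) : F (val y) = f y by rewrite /F valK.
  have Fv : F v = f u' by rewrite /F insubF ?eqxx.
  have Fu : F u = f u' by rewrite -[u]/(val u') Fval.
  pose pi x : contract u v := insubd u' x.
  have Fpi x : F x = f (pi x) by rewrite /F /pi /insubd; case: insub.
  have uvh h : f u' = Some h -> class_rel F h u v && class_rel F h v u.
    by move=> fu; rewrite [X in _ && X]class_rel_sym andbb /class_rel uv Fu Fv fu eqxx.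
  exists F; split.
  + by move=> h; have [x fx] := onto h; exists (val x); rewrite Fval.
  + have toval h x : F x = Some h ->
        connect (class_rel F h) x (val (pi x)) && connect (class_rel F h) (val (pi x)) x.
      move=> Fx; rewrite /pi /insubd; case: insubP => [y _ -> /=|]; first by rewrite connect0.
      rewrite negbK => /eqP xv; move: Fx; rewrite xv Fv => /uvh /andP[h1 h2].
      by rewrite /= !connect1.
    move=> h x y Fx Fy; have /andP [cx _] := toval _ _ Fx; have /andP [_ cy] := toval _ _ Fy.
    apply: connect_trans cx (connect_trans _ cy).
    rewrite Fpi in Fx; rewrite Fpi in Fy.
    apply: (connect_hom _ (conn h _ _ Fx Fy)) => a b /and3P [] /andP [_].
    case/or3P=> [ab fa fb|/andP[/eqP au vb] fa fb|/andP[/eqP bu va] fa fb].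
    * by apply: connect1; rewrite /class_rel ab !Fval fa.
    (* An edge of the contraction that is owed to [v] becomes a detour through the edge [uv], both
       ends of which carry the same label. *)
    * have fu : f u' = Some h by rewrite -Fu -au Fval (eqP fa).
      have /andP [h1 _] := uvh _ fu; rewrite au.
      apply: connect_trans (connect1 h1) (connect1 _).
      by rewrite /class_rel vb Fv fu eqxx Fval.
    * have fu : f u' = Some h by rewrite -Fu -bu Fval (eqP fb).
      have /andP [_ h1] := uvh _ fu; rewrite bu.
      apply: connect_trans (connect1 _) (connect1 h1).
      by rewrite /class_rel adj_sym va Fv fu eqxx Fval fa.
  + move=> h h' hh'; split.
      case/fadj=> // x [y [fx fy /andP [_ /or3P]]].
      case=> [xy|/andP[/eqP xu vy]|/andP[/eqP yu vx]].
      * by exists (val x), (val y); rewrite !Fval.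
      * by exists v, (val y); rewrite Fval Fv -Fu -xu Fval.
      * by exists (val x), v; rewrite Fval Fv -Fu -yu Fval adj_sym.
    case=> x [y [Fx Fy xy]]; apply/fadj => //; exists (pi x), (pi y).
    rewrite -!Fpi; split=> //; apply/andP; split.
      by apply: contraNneq hh' => pixy; move: Fx; rewrite Fpi pixy -Fpi Fy => -[->].
    rewrite /pi !val_insubd; case: (altP (x =P v)) => [xv|xv] /=.
      case: (altP (y =P v)) => [yv|yv] /=; last by rewrite eqxx -xv xy !orbT.
      by move: xy; rewrite xv yv adj_irrefl.
    case: (altP (y =P v)) => [yv|yv] /=; last by rewrite xy.
    by rewrite eqxx -yv [adj y x]adj_sym xy !orbT.
Qed.

(** Induction on the number of vertices. An unlabelled vertex is deleted; if all are labelled and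
    two share a label, an edge inside their branch set is contracted; if none do, the labelling is
    an isomorphism. *)
Lemma model_induced_minor (G : sgraph) (f : G -> option H) :
  model f -> induced_minor H G.
Proof.
have [m] := ubnP #|G|; elim: m G f => // m IH G f Gm [onto conn fadj].
have card_sub (v : G) : #|{: {x : G | x != v}}| < m.
  rewrite card_sig -ltnS; apply: leq_trans Gm; rewrite ltnS.
  by rewrite (cardD1 v predT) /= add1n ltnS; apply: eq_leq; apply: eq_card => x; rewrite !inE andbT.
have [[v /eqP fv]|allS] := altP (@existsP _ (fun v : G => f v == None)).
  apply: (IMdelete (v := v)); apply: (IH _ (fun x : delete v => f (val x))).
    exact: card_sub.
  have lift x h : f x = Some h -> exists2 y : delete v, val y = x & f (val y) = Some h.
    move=> fx; have xv : x != v by apply: contra_eq_neq fx => ->; rewrite fv.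
    by exists (Sub x xv).
  split.
  - by move=> h; have [x /lift [y _ fy]] := onto h; exists y.
  - move=> h x y fx fy.
    pose g z : delete v := insubd x z.
    have := conn h _ _ fx fy => /(@connect_hom _ _ _ (class_rel (fun x : delete v => f (val x)) h) g).
    rewrite /g !valKd; apply => a b /and3P [ab fa fb]; apply: connect1.
    have [a' aE _] := lift _ _ (eqP fa); have [b' bE _] := lift _ _ (eqP fb).
    by rewrite -aE -bE !valKd /class_rel aE bE fa fb !andbT -aE -bE in ab *.
  - move=> h h' hh'; split.
      case/fadj=> // x [y [/lift [x' <- fx] /lift [y' <- fy] xy]].
      by exists x', y'.
    by case=> x [y [fx fy xy]]; apply/fadj => //; exists (val x), (val y).
have fS x : exists h, f x == Some h.
  case fx: (f x) => [h|]; first by exists h.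
  by case/existsP: allS; exists x; rewrite fx.
have [inj_f|/injectivePn [x [y xy fxy]]] := altP (@injectiveP _ _ f).
  pose g x := xchoose (fS x).
  have fg x : f x = Some (g x) by apply/eqP/(xchooseP (fS x)).
  have onto' h : exists x, f x == Some h by have [x <-] := onto h; exists x.
  pose g' h := xchoose (onto' h).
  have fg' h : f (g' h) = Some h by apply/eqP/(xchooseP (onto' h)).
  have g'K : cancel g' g by move=> h; apply: Some_inj; rewrite -fg fg'.
  have gK : cancel g g' by move=> x; apply: inj_f; rewrite fg' fg.
  apply: IMiso; exists g; split; first by exists g'.
  move=> x y; have [<-|xy] := eqVneq x y; first by rewrite !adj_irrefl.
  have gxy : g x != g y by rewrite (can_eq gK).
  apply/idP/idP => [/fadj|xy']; last by apply/fadj => //; exists x, y; rewrite !fg.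
  by case=> // a [b []]; rewrite -!fg => /inj_f -> /inj_f ->.
(* The first edge of a path inside the branch set of [x] and [y]; the path is not empty since
   [x != y]. *)
have [a [b [ab fab]]] : exists a b, adj a b /\ f a = f b.
  have [h /eqP fx] := fS x.
  have /connectP [[|z p] /= pth yE] := conn h x y fx (etrans (esym fxy) fx).
    by rewrite yE eqxx in xy.
  by case/andP: pth => /and3P [xz /eqP fx' /eqP fz] _; exists x, z; rewrite fx' fz.
have aNb : a != b by apply: contraTneq ab => ->; rewrite adj_irrefl.
apply: (IMcontract ab); pose a' : contract a b := Sub a aNb.
pose pi z : contract a b := insubd a' z.
have fpi z : f (val (pi z)) = f z.
  by rewrite val_insubd; case: eqP => [->|].
have pi_adj z z' : adj z z' -> pi z != pi z' -> adj (pi z) (pi z').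
  move=> zz' pizz'; apply/andP; split=> //; rewrite /pi !val_insubd.
  case: (altP (z =P b)) => [zb|zb] /=.
    case: (altP (z' =P b)) => [zb'|zb'] /=; last by rewrite eqxx -zb zz' !orbT.
    by move: zz'; rewrite zb zb' adj_irrefl.
  case: (altP (z' =P b)) => [zb'|zb'] /=; last by rewrite zz'.
  by rewrite eqxx -zb' [adj z' z]adj_sym zz' !orbT.
apply: (IH _ (fun x : contract a b => f (val x))); first exact: card_sub.
split.
- by move=> h; have [z fz] := onto h; exists (pi z); rewrite fpi.
- move=> h z z' fz fz'; rewrite -[z](valKd a') -[z'](valKd a').
  apply: (connect_hom _ (conn h _ _ fz fz')) => c d /and3P [cd fc fd].
  rewrite -/(pi c) -/(pi d).
  have [->|picd] := eqVneq (pi c) (pi d); first exact: connect0.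
  by apply: connect1; rewrite /class_rel pi_adj // !fpi fc fd.
- move=> h h' hh'; split.
    case/fadj=> // c [d [fc fd cd]]; exists (pi c), (pi d); rewrite !fpi.
    split=> //; apply: pi_adj => //; apply: contraNneq hh' => picd.
    by apply/eqP/Some_inj; rewrite -fc -fd -(fpi c) picd fpi.
  case=> c [d [fc fd /andP [_ /or3P]]].
  case=> [cd|/andP[/eqP ca bd]|/andP[/eqP da bc]]; apply/fadj => //.
  + by exists (val c), (val d).
  + by exists b, (val d); rewrite -fab -ca.
  + by exists (val c), b; rewrite -fab -da adj_sym.
Qed.

End Models.

(** * Shortest paths in graphs without an induced [P_t] *)

Section ShortPaths.
Variables (t : nat) (G : sgraph).
Hypothesis Pt_free : path_free t G.

(** In a walk of minimal length a repeated vertex or a chord would give a shortcut. With [t] or more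
    vertices, its first [t] vertices would therefore induce [P_t]. *)
Lemma short_path (P : pred G) (x y : G) :
  connect (fun a b => [&& adj a b, P a & P b]) x y ->
  exists p, [/\ path (fun a b => [&& adj a b, P a & P b]) x p,
                last x p = y & (size p).+1 < t].
Proof.
set e := (fun a b => _); case/connectP=> p0 pth0 y0.
pose R n := [exists p : n.-tuple G, path e x p && (last x p == y)].
have exR : exists n, R n.
  exists (size p0); apply/existsP; exists (in_tuple p0).
  by rewrite pth0 y0 eqxx.
case: (ex_minnP exR) => m /existsP [p /andP [pth /eqP lst]] mmin.
have minp q : path e x q -> last x q = y -> size p <= size q.
  move=> qpth qlst; rewrite size_tuple; apply: mmin; apply/existsP.
  by exists (in_tuple q); rewrite qpth qlst eqxx.
move: (tval p) pth lst minp => {}p pth lst minp.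
exists p; split=> //; rewrite ltnNge; apply/negP => tp.
pose s := x :: p; pose v i := nth x s i.
have lastv i : i <= size p -> last x (take i p) = v i.
  move=> ip; rewrite (last_nth x) size_takel //.
  by rewrite -[x :: take i p]/(take i.+1 s) nth_take.
have cut i : i <= size p -> path e (v i) (drop i p) /\ last (v i) (drop i p) = y.
  move=> ip; move: pth lst; rewrite -{1 2}(cat_take_drop i p) cat_path last_cat lastv //.
  by case/andP.
have takep i : path e x (take i p) by apply: take_path.
have v_inj i j : i < j -> j <= size p -> v i != v j.
  move=> ij jp; apply/eqP => vij; have [pj lj] := cut j jp.
  have ip : i <= size p by lia.
  have := minp (take i p ++ drop j p).
  rewrite cat_path last_cat lastv // vij takep pj lj size_cat size_takel // size_drop.
  by move=> /(_ isT erefl); lia.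
have v_adj i j : i < j -> j <= size p -> adj (v i) (v j) = (i.+1 == j).
  move=> ij jp; have ip : i <= size p by lia.
  have ev l : l < size p -> e (v l) (v l.+1) by move=> lp; apply: (pathP x pth).
  apply/idP/eqP => [aij|<-]; last by have /andP [] := ev i (leq_trans ij jp).
  have [pj lj] := cut j jp.
  (* The chord stays inside [P]: the walk leaves [v i] and enters [v j] by edges of [e]. *)
  have eij : e (v i) (v j).
    have /and3P [_ Pi _] := ev i (leq_trans ij jp).
    case: j ij jp {pj lj} aij => // j _ jp aij; have /and3P [_ _ Pj] := ev j jp.
    exact/and3P.
  have := minp (take i p ++ v j :: drop j p).
  rewrite cat_path last_cat lastv //= eij takep pj lj size_cat size_takel //= size_drop.
  by move=> /(_ isT erefl); lia.
have vE i j : i <= size p -> j <= size p ->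
    ((v i == v j) = (i == j)) * (adj (v i) (v j) = ((i.+1 == j) || (j.+1 == i))).
  move=> ip jp; case: (ltngtP i j) => [ij|ji|->]; last first.
  - by rewrite adj_irrefl !eqxx; split=> //; lia.
  - by rewrite eq_sym (negbTE (v_inj j i ji ip)) adj_sym v_adj //; split=> //; lia.
  - by rewrite (negbTE (v_inj i j ij jp)) v_adj //; split=> //; lia.
have it (i : 'I_t) : i <= size p by have := ltn_ord i; lia.
pose S := [set v i | i : 'I_t].
case: (Pt_free (S := S)).
have vS (i : 'I_t) : v i \in S by apply: imset_f.
pose g' (i : 'I_t) : induced (fun z => z \in S) := Sub (v i) (vS i).
have inv (z : induced (fun z => z \in S)) : exists i : 'I_t, v i == val z.
  by have /imsetP [i _ zi] := valP z; exists i; rewrite zi.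
pose g z := xchoose (inv z).
have vg z : v (g z) = val z by apply/eqP/(xchooseP (inv z)).
exists g; split.
  exists g' => [z|i]; first by apply: val_inj; rewrite /= vg.
  have := vg (g' i); rewrite /= => /eqP; rewrite vE // => /eqP; exact: val_inj.
by move=> a b; rewrite /= /path_adj /induced_adj -!vg vE.
Qed.

End ShortPaths.

(** * Bounded models *)

Section SmallModels.
Variables (H : sgraph) (t : nat).

(* [(h', b, i)] is the [i]-th vertex on a path to a vertex seeing the branch
   set of [h']; both ends of an edge chosen for the ordered pair [(h, h')] are
   kept, whence [b]. *)
Definition slot : finType := (H * bool * 'I_t)%type.

Definition pattern (I : finType) (G : sgraph) (x : I -> G) :
  {ffun I * I -> bool * bool} :=
  [ffun ij => (adj (x ij.1) (x ij.2), x ij.1 == x ij.2)].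

Definition good_pattern (d : {ffun (H * slot) * (H * slot) -> bool * bool}) : bool :=
  [&& [forall h, forall j, forall j',
         connect (fun a b => (d ((h, a), (h, b))).1 || (d ((h, a), (h, b))).2) j j'],
      [forall h, forall h', forall j, forall j',
         (h != h') ==> ~~ (d ((h, j), (h', j'))).2] &
      [forall h, forall h', (h != h') ==>
         (adj h h' == [exists j, exists j', (d ((h, j), (h', j'))).1])]].

Lemma good_patternP (G : sgraph) (x : H * slot -> G) :
  reflect [/\ forall h j j',
                connect (fun a b => adj (x (h, a)) (x (h, b)) || (x (h, a) == x (h, b))) j j',
              forall h h' j j', x (h, j) = x (h', j') -> h = h' &
              forall h h', h != h' ->
                (adj h h' <-> exists j j', adj (x (h, j)) (x (h', j')))]
          (good_pattern (pattern x)).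
Proof.
have conE h : connect (fun a b => (pattern x ((h, a), (h, b))).1 || (pattern x ((h, a), (h, b))).2)
    =2 connect (fun a b => adj (x (h, a)) (x (h, b)) || (x (h, a) == x (h, b))).
  by apply: eq_connect => a b; rewrite !ffunE.
have exE h h' : reflect (exists j j', adj (x (h, j)) (x (h', j')))
    [exists j, exists j', (pattern x ((h, j), (h', j'))).1].
  apply: (iffP existsP) => [[j /existsP [j']]|[j [j' a]]].
    by rewrite ffunE => a; exists j, j'.
  by exists j; apply/existsP; exists j'; rewrite ffunE.
apply: (iffP and3P) => [[con dis ad]|[con dis ad]]; split.
- by move=> h j j'; move/forallP/(_ h)/forallP/(_ j)/forallP/(_ j'): con; rewrite conE.
- move=> h h' j j' /eqP xx; apply/eqP; apply: contraTT xx => hh'.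
  by move/forallP/(_ h)/forallP/(_ h')/forallP/(_ j)/forallP/(_ j'): dis; rewrite hh' ffunE.
- move=> h h' hh'; move/forallP/(_ h)/forallP/(_ h'): ad; rewrite hh' => /eqP ->.
  by split => /exE.
- by apply/forallP => h; apply/forallP => j; apply/forallP => j'; rewrite conE.
- apply/forallP => h; apply/forallP => h'; apply/forallP => j; apply/forallP => j'.
  by apply/implyP; apply: contraNN; rewrite ffunE => /eqP /dis ->.
- apply/forallP => h; apply/forallP => h'; apply/implyP => hh'; apply/eqP.
  by apply/idP/exE => /ad; apply.
Qed.

Hypothesis t_gt0 : 0 < t.

(** Each vertex of the tuple is labelled by the [h] of its slots, unique by disjointness; all other
    vertices are deleted. Equality links between slots collapse in [G], so only adjacency links
    remain. *)
Lemma good_pattern_sound (G : sgraph) (x : H * slot -> G) :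
  good_pattern (pattern x) -> induced_minor H G.
Proof.
case/good_patternP=> con dis ad.
pose f g := [pick h | [exists j, x (h, j) == g]].
have fx h j : f (x (h, j)) = Some h.
  rewrite /f; case: pickP => [h' /existsP [j' /eqP /dis ->] //|/(_ h)].
  by move/existsP; case; exists j.
have fS g h : f g = Some h -> exists j, x (h, j) = g.
  by rewrite /f; case: pickP => // h' /existsP [j' /eqP <-] [<-]; exists j'.
apply: (@model_induced_minor _ _ f); split.
- by move=> h; exists (x (h, (h, true, Ordinal t_gt0))).
- move=> h a b /fS [j <-] /fS [j' <-].
  apply: (connect_hom (g := fun j => x (h, j)) _ (con h j j')) => i i'.
  case/orP=> [ii'|/eqP ->]; last exact: connect0.
  by apply: connect1; rewrite /class_rel ii' !fx eqxx.
- move=> h h' hh'; split.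
    by case/ad=> // j [j' jj']; exists (x (h, j)), (x (h', j')).
  case=> a [b [/fS [j <-] /fS [j' <-] ab]]; apply/ad => //.
  by exists j, j'.
Qed.

Lemma good_pattern_complete (G : sgraph) : path_free t G ->
  induced_minor H G -> exists x : H * slot -> G, good_pattern (pattern x).
Proof.
move=> Ptf /induced_minor_model [f [onto conn fadj]].
have onto' h : exists x, f x == Some h by have [x <-] := onto h; exists x.
pose r h := xchoose (onto' h).
have fr h : f (r h) = Some h by apply/eqP/(xchooseP (onto' h)).
(* When no edge joins the two branch sets the roots serve as dummies, so that every slot has a path
   to lie on. *)
pose ends h h' : G * G := odflt (r h, r h')
  [pick ab : G * G | [&& f ab.1 == Some h, f ab.2 == Some h' & adj ab.1 ab.2]].
have endsP h h' : [/\ f (ends h h').1 = Some h, f (ends h h').2 = Some h' &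
    h != h' -> adj h h' -> adj (ends h h').1 (ends h h').2].
  rewrite /ends; case: pickP => [[a b] /and3P [/eqP -> /eqP -> ab] //|no /=].
  rewrite !fr; split=> // hh' /fadj; case=> // a [b [fa fb ab]].
  by have := no (a, b); rewrite /= fa fb ab !eqxx.
pose term h (hb : H * bool) := if hb.2 then (ends h hb.1).1 else (ends hb.1 h).2.
have fterm h hb : f (term h hb) = Some h.
  by rewrite /term; case: hb.2; have [? ? _] := endsP h hb.1; have [? ? _] := endsP hb.1 h.
have short h hb : exists p, [&& path (class_rel f h) (r h) p,
    last (r h) p == term h hb & (size p).+1 < t].
  have [p [p1 p2 p3]] := short_path Ptf (P := fun z => f z == Some h)
    (conn h _ _ (fr h) (fterm h hb)).
  by exists p; rewrite p1 p2 eqxx p3.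
pose p h hb := xchoose (short h hb).
have pP h hb : [&& path (class_rel f h) (r h) (p h hb),
    last (r h) (p h hb) == term h hb & (size (p h hb)).+1 < t] := xchooseP (short h hb).
move: p pP => p pP {short}.
(* The default value of [nth] does the padding: beyond the end of the path the slots repeat its last
   vertex. *)
pose x (hj : H * slot) := nth (term hj.1 hj.2.1) (r hj.1 :: p hj.1 hj.2.1) hj.2.2.
have fx h j : f (x (h, j)) = Some h.
  have /and3P [pth _ _] := pP h j.1; rewrite /x /=.
  have fall : all (fun z => f z == Some h) (r h :: p h j.1).
    rewrite /= fr eqxx /=; elim: (p h j.1) (r h) pth => //= z q IH y.
    by case/andP=> /and3P [_ _ ->] /IH.
  have [jlt|jge] := ltnP j.2 (size (r h :: p h j.1)).
    exact/eqP/(all_nthP _ fall).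
  by rewrite nth_default ?fterm.
have xterm h hb : exists j, x (h, j) = term h hb.
  have /and3P [_ /eqP lst pt] := pP h hb.
  exists (hb, Ordinal (ltn_trans (ltnSn _) pt)); rewrite /x /=.
  by rewrite (set_nth_default (r h)) // -[nth _ _ _]/(nth (r h) (r h :: _) (size (p h hb))) -last_nth.
exists x; apply/good_patternP; split.
- move=> h j j'; set e := (fun a b => _).
  have esym : connect_sym e.
    by apply: sym_connect_sym => a b; rewrite /e adj_sym eq_sym.
  pose o (hb : H * bool) : slot := (hb, Ordinal t_gt0).
  (* Consecutive slots of a path are adjacent or equal, so each slot is linked to slot 0 of its
     path. All slots 0 of [h] hold the root, hence are linked by equality. *)
  have to0 a : connect e (o a.1) a.
    case: a => hb [i it]; rewrite /o /=; elim: i it => [|i IH] it.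
      by rewrite (bool_irrelevance it t_gt0) connect0.
    apply: connect_trans (IH (ltnW it)) (connect1 _); rewrite /e /x /=.
    have /and3P [pth /eqP lst _] := pP h hb.
    case: (ltngtP i (size (p h hb))) => ip.
    + have /(pathP (term h hb)) /(_ i ip) /andP [-> //] := pth.
    + by rewrite nth_default /= 1?[nth _ (p h hb) i]nth_default ?eqxx ?orbT // ltnW.
    + rewrite [nth _ (p h hb) i]nth_default ?ip //; apply/orP; right.
      rewrite (set_nth_default (r h)) /= ?ip //.
      by rewrite -last_nth lst.
  apply: connect_trans (connect_trans _ (to0 j')).
    by rewrite esym; apply: to0.
  by apply: connect1; rewrite /e /x /= eqxx orbT.
- by move=> h h' j j' xx; apply: Some_inj; rewrite -(fx h j) xx fx.
- move=> h h' hh'; split=> [hadj|[j [j' jj']]].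
    have [j xj] := xterm h (h', true); have [j' xj'] := xterm h' (h, false).
    exists j, j'; rewrite xj xj' /term /=.
    by have [_ _] := endsP h h'; apply.
  by apply/fadj => //; exists (x (h, j)), (x (h', j')).
Qed.

End SmallModels.

(** * Tapes with a head position *)

(** With absolute positions a head move changes a number and only a write changes the list. A write
    at [p = size s] extends the list; a left move from 0 would leave the cells described. *)
Definition tape_at A (s : seq (option A)) (p : nat) : tape A :=
  (rev (take p s), drop p s).

Lemma tape_at_read A (s : seq (option A)) p : tape_read (tape_at s p) = nth None s p.
Proof. by rewrite /tape_read /tape_at -nth0 nth_drop addn0. Qed.

Definition move_pos (m : move) (p : nat) : nat :=
  match m with MoveL => p.-1 | MoveN => p | MoveR => p.+1 end.

Lemma tape_at_act A (s : seq (option A)) p c m :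
  p <= size s -> (if m is MoveL then 0 < p else true) ->
  tape_act (tape_at s p) (c, m) = tape_at (set_nth None s p c) (move_pos m p).
Proof.
move=> ps; have sE : set_nth None s p c = take p s ++ c :: behead (drop p s).
  rewrite set_nthE; case: ltnP => [plt|pge].
    by rewrite (drop_nth None plt).
  have -> : p = size s by apply/eqP; rewrite eqn_leq ps.
  by rewrite take_size drop_size /ncons subnn.
have ts : size (take p s) = p by rewrite size_takel.
rewrite sE /tape_at; case: m => /= m_ok.
- case: p ps ts m_ok {sE} => // p ps ts _.
  have [u [c' E]] : exists u c', take p.+1 s = rcons u c'.
    by case/lastP: (take p.+1 s) ts => // u c' _; exists u, c'.
  have up : size u = p by move: ts; rewrite E size_rcons => -[].
  by rewrite E rev_rcons cat_rcons take_cat drop_cat up ltnn subnn take0 drop0 cats0.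
- by rewrite take_cat drop_cat ts ltnn subnn take0 drop0 cats0.
- by rewrite take_cat drop_cat ts ltnNge leqnSn /= subSnn /= take0 drop0 cats1 rev_rcons.
Qed.

(** * The machine *)

Section Machine.
Variables (k : nat) (Q : pred {ffun 'I_k * 'I_k -> bool * bool}).

Let acc := {ffun 'I_k * 'I_k -> bool * bool}.
Let sym := option (bool + {set 'I_k}).
Let action := (sym * move)%type.

(* Tape 0 holds the input, with the separator overwritten by [mark].  Tapes 1
   and 2 both hold the current tuple [x]: between two [sharp] cells, one cell
   per vertex [p], containing the set of the indices [i] with [x i = p].

   [Copy]     writes the tuple with all entries 0; the flag is set on the first cell;
   [Skip]     goes to the right end of tape 0;
   [Home]     rewinds all tapes, then begins a scan ([None]) or goes to [Begin j];
   [Scan]     reads the adjacency matrix once, tapes 1 and 2 following the row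
              and the column, and collects the pattern of the tuple;
   [Return]   rewinds tape 2 at the end of a row;
   [Begin j]  resets the entry [j - 1] to 0 (nothing if [j = 0]);
   [Inc j]    looks for the entry [j] in order to increase it, and rejects if
              [j = k];
   [Put i]    has removed the entry [i] and is one cell to its right. *)
Inductive state :=
  Start | Copy of bool | Skip | Home of option 'I_k.+1 | Scan of acc
| Return of acc | Begin of 'I_k.+1 | Inc of 'I_k.+1 | Put of 'I_k | Halt of bool.

Definition state_code (q : state) :
  (unit + bool + unit + option 'I_k.+1) +
  (acc + acc + 'I_k.+1) + ('I_k.+1 + 'I_k + bool) :=
  match q with
  | Start => inl (inl (inl (inl (inl tt))))
  | Copy b => inl (inl (inl (inl (inr b))))
  | Skip => inl (inl (inl (inr tt)))
  | Home g => inl (inl (inr g))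
  | Scan d => inl (inr (inl (inl d)))
  | Return d => inl (inr (inl (inr d)))
  | Begin j => inl (inr (inr j))
  | Inc j => inr (inl (inl j))
  | Put i => inr (inl (inr i))
  | Halt b => inr (inr b)
  end.

Definition state_decode c : state :=
  match c with
  | inl (inl (inl (inl (inl tt)))) => Start
  | inl (inl (inl (inl (inr b)))) => Copy b
  | inl (inl (inl (inr tt))) => Skip
  | inl (inl (inr g)) => Home g
  | inl (inr (inl (inl d))) => Scan d
  | inl (inr (inl (inr d))) => Return d
  | inl (inr (inr j)) => Begin j
  | inr (inl (inl j)) => Inc j
  | inr (inl (inr i)) => Put i
  | inr (inr b) => Halt b
  end.

Lemma state_codeK : cancel state_code state_decode. Proof. by case. Qed.

HB.instance Definition _ := Finite.copy state (can_type state_codeK).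

(** The two summands of the alphabet act as markers: after the setup the only [inr] cell of tape 0
    is the mark, and the only [inl] cells of tapes 1 and 2 are their borders. *)
Definition sharp : sym := Some (inl true).
Definition mark : sym := Some (inr set0).
Definition is_sharp (c : sym) := if c is Some (inl _) then true else false.
Definition is_mark (c : sym) := if c is Some (inr _) then true else false.

Definition acc0 : acc := [ffun=> (false, false)].

(** [S] and [S'] are the indices whose entries are the current row and column. For [j] in [S'],
    membership of [i] in [S'] says that the entries [i] and [j] are equal. *)
Definition acc_add (d : acc) (S S' : {set 'I_k}) (c : sym) : acc :=
  [ffun ij => if (ij.1 \in S) && (ij.2 \in S')
              then (c == Some (inl true), ij.1 \in S') else d ij].

Definition delta (q : state) (c0 c1 c2 : sym) : state * (action * action * action) :=
  let stay := (c0, MoveN) in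
  let keep q m0 m1 m2 := (q, ((c0, m0), (c1, m1), (c2, m2))) in
  let both q c m := (q, (stay, (c, m), (c, m))) in
  match q with
  | Start => both (Copy true) sharp MoveR
  | Copy first =>
      if c0 is Some (inl true) then
        let c := Some (inr (if first then [set: 'I_k] else set0)) in
        (Copy false, ((c0, MoveR), (c, MoveR), (c, MoveR)))
      else (if first then Halt ((k == 0) && Q acc0) else Skip,
            ((mark, MoveR), (sharp, MoveL), (sharp, MoveL)))
  | Skip => if c0 is None then keep (Home None) MoveL MoveN MoveN
            else keep Skip MoveR MoveN MoveN
  | Home g =>
      if [&& is_mark c0, is_sharp c1 & is_sharp c2] then
        keep (if g is Some j then Begin j else Scan acc0) MoveR MoveR MoveR
      else keep (Home g) (if is_mark c0 then MoveN else MoveL)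
                         (if is_sharp c1 then MoveN else MoveL)
                         (if is_sharp c2 then MoveN else MoveL)
  | Scan d =>
      match c1, c2 with
      | Some (inr U), Some (inr U') =>
          keep (Scan (acc_add d U U' c0)) MoveR MoveN MoveR
      | Some (inr _), _ => keep (Return d) MoveN MoveR MoveL
      | _, _ => keep (if Q d then Halt true else Home (Some ord0)) MoveN MoveL MoveN
      end
  | Return d => if is_mark c2 then keep (Return d) MoveN MoveN MoveL
                else keep (Scan d) MoveN MoveN MoveR
  | Begin j =>
      if c1 is Some (inr U)
      then both (Inc j) (Some (inr (U :|: [set i | lift ord0 i == j]))) MoveN
      else keep (Halt false) MoveN MoveN MoveN
  | Inc j =>
      if (insub (val j), c1) is (Some i, Some (inr U)) then
        if i \in U then both (Put i) (Some (inr (U :\ i))) MoveR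
        else both (Inc j) c1 MoveR
      else keep (Halt false) MoveN MoveN MoveN
  | Put i =>
      if c1 is Some (inr U) then both (Home None) (Some (inr (i |: U))) MoveN
      else keep (Home (Some (lift ord0 i))) MoveN MoveL MoveL
  | Halt b => keep (Halt b) MoveN MoveN MoveN
  end.

Definition tri {A} (a0 a1 a2 : A) (i : 'I_3) : A :=
  match val i with 0 => a0 | 1 => a1 | _ => a2 end.

Definition machine : tm :=
  @TM 2 {set 'I_k} state Start (fun q => if q is Halt b then Some b else None)
    (fun q r => let: (q', (a0, a1, a2)) := delta q (r ord0) (r (lift ord0 ord0)) (r ord_max) in
                (q', [ffun i => tri a0 a1 a2 i])).

(** Tapes 1 and 2 always have the same content and differ in head position only, hence a single
    [s]. *)
Definition cfg q s0 p0 s p1 p2 : tm_config machine :=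
  (q, [ffun i => tri (tape_at s0 p0) (tape_at s p1) (tape_at s p2) i]).

Definition legal (p : nat) (T : Type) (s : seq T) (m : move) :=
  (p <= size s) && (if m is MoveL then 0 < p else true).

Lemma step_cfg q s0 p0 s p1 p2 q' c0 m0 c1 m1 c2 m2 s' :
  (if q is Halt _ then false else true) ->
  delta q (nth None s0 p0) (nth None s p1) (nth None s p2) =
    (q', ((c0, m0), (c1, m1), (c2, m2))) ->
  legal p0 s0 m0 -> legal p1 s m1 -> legal p2 s m2 ->
  set_nth None s p1 c1 = s' -> set_nth None s p2 c2 = s' ->
  tm_step (cfg q s0 p0 s p1 p2) =
  cfg q' (set_nth None s0 p0 c0) (move_pos m0 p0) s' (move_pos m1 p1) (move_pos m2 p2).
Proof.
move=> qH dE /andP[l0 l0'] /andP[l1 l1'] /andP[l2 l2'] s1 s2.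
rewrite /tm_step /=; have -> : (if q is Halt b then Some b else None) = None by case: q qH dE.
rewrite !ffunE /= !tape_at_read dE; congr pair.
apply/ffunP => i; rewrite !ffunE /tri.
case: i => -[|[|[|//]]] /= _; first exact: tape_at_act.
  by rewrite -s1; apply: tape_at_act.
by rewrite -s2; apply: tape_at_act.
Qed.

(** * Runs of bounded length *)

Definition reach (b : nat) (c c' : tm_config machine) : Prop :=
  exists2 m, m <= b & iter m (tm_step (M := machine)) c = c'.

Lemma reach_refl c : reach 0 c c. Proof. by exists 0. Qed.

Lemma reach_trans b1 b2 c1 c2 c3 :
  reach b1 c1 c2 -> reach b2 c2 c3 -> reach (b1 + b2) c1 c3.
Proof.
move=> [m1 h1 e1] [m2 h2 e2]; exists (m2 + m1); first by rewrite addnC leq_add.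
by rewrite iterD e1 e2.
Qed.

Lemma reach_step b c c' : reach b (tm_step c) c' -> reach b.+1 c c'.
Proof. by case=> m h e; exists m.+1; rewrite ?iterSr. Qed.

Lemma reach_le b b' c c' : reach b c c' -> b <= b' -> reach b' c c'.
Proof. by move=> [m h e] bb'; exists m => //; apply: leq_trans bb'. Qed.

Lemma set_nth_id (T : Type) (x0 : T) s p : p < size s -> set_nth x0 s p (nth x0 s p) = s.
Proof. by move=> ps; rewrite set_nthE ps -drop_nth // cat_take_drop. Qed.

Lemma step_keep q s0 p0 s p1 p2 q' m0 m1 m2 :
  (if q is Halt _ then false else true) ->
  delta q (nth None s0 p0) (nth None s p1) (nth None s p2) =
    (q', ((nth None s0 p0, m0), (nth None s p1, m1), (nth None s p2, m2))) ->
  legal p0 s0 m0 -> legal p1 s m1 -> legal p2 s m2 ->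
  p0 < size s0 -> p1 < size s -> p2 < size s ->
  tm_step (cfg q s0 p0 s p1 p2) =
  cfg q' s0 (move_pos m0 p0) s (move_pos m1 p1) (move_pos m2 p2).
Proof.
by move=> qH dE l0 l1 l2 h0 h1 h2; rewrite (step_cfg qH dE l0 l1 l2 (s' := s)) ?set_nth_id.
Qed.

Lemma step_both q s0 p0 s p q' c m s' :
  (if q is Halt _ then false else true) ->
  delta q (nth None s0 p0) (nth None s p) (nth None s p) =
    (q', ((nth None s0 p0, MoveN), (c, m), (c, m))) ->
  legal p s m -> p0 < size s0 -> set_nth None s p c = s' ->
  tm_step (cfg q s0 p0 s p p) = cfg q' s0 p0 s' (move_pos m p) (move_pos m p).
Proof.
move=> qH dE l h0 sE.
by rewrite (step_cfg qH dE _ l l sE) ?set_nth_id // /legal ltnW.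
Qed.

Definition halts (b : nat) (c : tm_config machine) (r : bool) : Prop :=
  exists2 c', reach b c c' & c'.1 = Halt r.

Lemma reach_halts b1 b2 c1 c2 r :
  reach b1 c1 c2 -> halts b2 c2 r -> halts (b1 + b2) c1 r.
Proof. by move=> c12 [c3 c23 out]; exists c3 => //; apply: reach_trans c12 c23. Qed.

Lemma halts_le b b' c r : halts b c r -> b <= b' -> halts b' c r.
Proof. by move=> [c' cc' out] bb'; exists c' => //; apply: reach_le cc' bb'. Qed.

Lemma halts_answer b w r : halts b (tm_init machine w) r -> tm_answer machine w b = Some r.
Proof.
case=> c [m mb mc] out; rewrite /tm_answer -(subnK mb) iterD mc.
have fix_c i : iter i (tm_step (M := machine)) c = c.
  elim: i => //= i ->; rewrite /tm_step; case: c out {mc} => /= q tp qE.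
  by rewrite qE.
by rewrite fix_c /= out.
Qed.

(** * Tape contents for a graph with at least one vertex *)

Section Run.
Variables (n : nat) (bits : seq bool).
Hypothesis n_gt0 : 0 < n.
Hypothesis size_bits : size bits = n * n.

(** The length of the input word, in which all running times are expressed. *)
Let N := n * n + n + 1.

(** The explicit blank is the cell on which a full sweep leaves the head. [Skip] visits it once, and
    from then on no step changes this list. *)
Definition matrix_tape : seq sym :=
  nseq n sharp ++ mark :: [seq Some (inl b) | b <- bits] ++ [:: None].

Lemma size_matrix_tape : size matrix_tape = n + n * n + 2.
Proof. by rewrite size_cat /= size_cat size_nseq size_map size_bits /=; lia. Qed.

Lemma nth_matrix_tape a :
  nth None matrix_tape (n + a) =
  if a == 0 then mark else if a <= n * n then Some (inl (nth false bits a.-1)) else None.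
Proof.
rewrite nth_cat size_nseq ltnNge leq_addr /= addKn; case: a => //= a.
rewrite nth_cat size_map size_bits; case: ltnP => an.
  by rewrite (nth_map false) ?size_bits.
by case: (a - n * n) => //= m; rewrite nth_nil.
Qed.

Lemma is_mark_matrix_tape a : is_mark (nth None matrix_tape (n + a)) = (a == 0).
Proof. by rewrite nth_matrix_tape; case: a => // a; case: ifP. Qed.

Implicit Types x y : {ffun 'I_k -> nat}.

Definition cell x p : sym := Some (inr [set i | x i == p]).

Definition marks x : seq sym := sharp :: rcons (mkseq (cell x) n) sharp.

Lemma size_marks x : size (marks x) = n.+2.
Proof. by rewrite /= size_rcons size_mkseq. Qed.

Lemma nth_marks x p : p < n -> nth None (marks x) p.+1 = cell x p.
Proof. by move=> pn; rewrite /= nth_rcons size_mkseq pn nth_mkseq. Qed.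

Lemma nth_marks_end x : nth None (marks x) n.+1 = sharp.
Proof. by rewrite /= nth_rcons size_mkseq ltnn eqxx. Qed.

Lemma is_sharp_marks x p : p <= n -> is_sharp (nth None (marks x) p) = (p == 0).
Proof. by case: p => // p pn; rewrite nth_marks. Qed.

Lemma set_nth_marks x y p (S : {set 'I_k}) : p < n ->
  (forall i, (i \in S) = (y i == p)) ->
  (forall q i, q < n -> q != p -> (x i == q) = (y i == q)) ->
  set_nth None (marks x) p.+1 (Some (inr S)) = marks y.
Proof.
move=> pn Sy xy.
apply: (@eq_from_nth _ None); first by rewrite size_set_nth !size_marks; lia.
move=> q; rewrite size_set_nth size_marks => qn; rewrite nth_set_nth /=.
case: q qn => [|q] qn //; rewrite eqSS -[RHS]/(nth None (marks y) q.+1).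
have [qn'|nq] := ltnP q n; last first.
  have -> : q = n by lia.
  by rewrite !nth_marks_end; case: eqP => // ?; lia.
rewrite !nth_marks //; case: (altP eqP) => [->|qp].
  by congr (Some (inr _)); apply/setP => i; rewrite inE Sy.
by congr (Some (inr _)); apply/setP => i; rewrite !inE xy.
Qed.

Definition upd x i p : {ffun 'I_k -> nat} := [ffun j => if j == i then p else x j].

Lemma marks_add x i p : n <= x i -> p < n ->
  set_nth None (marks x) p.+1 (Some (inr (i |: [set j | x j == p]))) = marks (upd x i p).
Proof.
move=> xi pn; apply: set_nth_marks => // [j|q j qn qp].
  by rewrite !inE ffunE; case: (altP (j =P i)) => // _; rewrite eqxx.
by rewrite ffunE; case: (eqVneq j i) => // ->; lia.
Qed.

(** The value [n] has no cell, so it encodes an entry that has been taken out and not yet put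
    back. *)
Lemma marks_remove x i : x i < n ->
  set_nth None (marks x) (x i).+1 (Some (inr ([set j | x j == x i] :\ i)))
  = marks (upd x i n).
Proof.
move=> xi; apply: set_nth_marks => // [j|q j qn qp].
  by rewrite !inE ffunE; case: (eqVneq j i) => //= _; lia.
by rewrite ffunE; case: (eqVneq j i) => // ->; lia.
Qed.

(** * Rewinding and sweeping the matrix *)

Definition after_home g := if g is Some j then Begin j else Scan acc0.

(** Every step brings each head one cell closer to its left marker unless it is there, so [M] bounds
    the largest distance. Heads 1 and 2 must start left of the right border, which would pass for
    the left one. *)
Lemma run_home g x M a p1 p2 : a <= M -> p1 <= M -> p2 <= M ->
  a <= n * n + 1 -> p1 <= n -> p2 <= n ->
  reach M.+1 (cfg (Home g) matrix_tape (n + a) (marks x) p1 p2)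
             (cfg (after_home g) matrix_tape n.+1 (marks x) 1 1).
Proof.
elim: M a p1 p2 => [|M IH] a p1 p2 aM p1M p2M an p1n p2n; apply: reach_step.
  move: aM p1M p2M; rewrite !leqn0 => /eqP -> /eqP -> /eqP ->.
  rewrite (@step_keep _ _ _ _ _ _ (after_home g) MoveR MoveR MoveR) //=
    ?is_mark_matrix_tape ?size_rcons ?size_mkseq ?size_matrix_tape //; try lia.
  - by rewrite addn0; apply: reach_refl.
  - by rewrite /legal size_matrix_tape; lia.
have [/and3P [/eqP -> /eqP -> /eqP ->]|nz] := boolP [&& a == 0, p1 == 0 & p2 == 0].
  rewrite (@step_keep _ _ _ _ _ _ (after_home g) MoveR MoveR MoveR) //=
    ?is_mark_matrix_tape ?size_rcons ?size_mkseq ?size_matrix_tape //; try lia.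
  - by rewrite addn0; exact: (reach_le (reach_refl _) (leq0n _)).
  - by rewrite /legal size_matrix_tape; lia.
rewrite (@step_keep _ _ _ _ _ _ (Home g)
  (if a == 0 then MoveN else MoveL) (if p1 == 0 then MoveN else MoveL)
  (if p2 == 0 then MoveN else MoveL)) //; first last.
- by rewrite size_marks; lia.
- by rewrite size_marks; lia.
- by rewrite size_matrix_tape; lia.
- by rewrite /legal size_marks; case: p2 {IH nz p2M} p2n => //= p2; lia.
- by rewrite /legal size_marks; case: p1 {IH nz p1M} p1n => //= p1; lia.
- by rewrite /legal size_matrix_tape; case: a {IH nz aM} an => //= a; lia.
- by rewrite /delta is_mark_matrix_tape !is_sharp_marks // (negbTE nz).
have -> : move_pos (if a == 0 then MoveN else MoveL) (n + a) = n + a.-1.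
  by case: a {IH nz aM an} => //= a; rewrite addnS.
have pos p : move_pos (if p == 0 then MoveN else MoveL) p = p.-1 by case: p.
by rewrite !pos; apply: IH; lia.
Qed.

Definition valid x := forall i, x i < n.

(* The pattern collected from the first [q] entries of the matrix. *)
Definition acc_upto x q : acc :=
  [ffun ij => if x ij.1 * n + x ij.2 < q
              then (nth false bits (x ij.1 * n + x ij.2), x ij.1 == x ij.2)
              else (false, false)].

Lemma rowcol_inj r c r' c' : c < n -> c' < n ->
  (r * n + c == r' * n + c') = (r == r') && (c == c').
Proof.
move=> cn cn'; apply/eqP/andP => [E|[/eqP -> /eqP -> //]].
have := congr1 (divn^~ n) E; have := congr1 (modn^~ n) E.
by rewrite !modnMDl !modn_small // !divnMDl // !divn_small // !addn0 => -> ->.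
Qed.

Lemma acc_upto_step x r c : valid x -> r < n -> c < n ->
  acc_add (acc_upto x (r * n + c)) [set i | x i == r] [set i | x i == c]
    (Some (inl (nth false bits (r * n + c)))) = acc_upto x (r * n + c.+1).
Proof.
move=> xv rn cn; apply/ffunP => -[i j]; rewrite !ffunE /= !inE addnS ltnS.
rewrite [x i * n + _ <= _]leq_eqVlt rowcol_inj //.
case: eqP => [-> |_] /=; case: eqP => [-> |_] //=.
by congr pair; case: (nth _ _ _).
Qed.

Lemma run_row x r c : valid x -> r < n -> c <= n ->
  reach (n - c)
    (cfg (Scan (acc_upto x (r * n + c))) matrix_tape (n + (r * n + c).+1) (marks x) r.+1 c.+1)
    (cfg (Scan (acc_upto x (r * n + n))) matrix_tape (n + (r * n + n).+1) (marks x) r.+1 n.+1).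
Proof.
move=> xv rn; move m: (n - c) => m'; elim: m' c m => [|m IH] c mE cn.
  have -> : c = n by lia.
  exact: reach_refl.
have cn' : c < n by lia.
have rcn : r * n + c < n * n.
  by apply: leq_trans (_ : r.+1 * n <= _); [rewrite mulSn; lia | rewrite leq_mul2r rn orbT].
apply: reach_step.
rewrite (@step_keep _ _ _ _ _ _ (Scan (acc_upto x (r * n + c.+1))) MoveR MoveN MoveR) //; first last.
- by rewrite size_marks; lia.
- by rewrite size_marks; lia.
- by rewrite size_matrix_tape; lia.
- by rewrite /legal size_marks; lia.
- by rewrite /legal size_marks; lia.
- by rewrite /legal size_matrix_tape; lia.
- by rewrite /delta !nth_marks //= nth_matrix_tape /= rcn acc_upto_step.
by rewrite /= -addnS -addnS -/(marks x); apply: IH; lia.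
Qed.

Lemma run_return d x p0 p1 p2 : p0 < n + n * n + 2 -> p1 < n.+2 -> p2 <= n ->
  reach p2.+1 (cfg (Return d) matrix_tape p0 (marks x) p1 p2)
             (cfg (Scan d) matrix_tape p0 (marks x) p1 1).
Proof.
move=> p0n p1n; elim: p2 => [|p2 IH] p2n; apply: reach_step.
  rewrite (@step_keep _ _ _ _ _ _ (Scan d) MoveN MoveN MoveR);
    rewrite /legal ?size_marks ?size_matrix_tape //; try lia.
  exact: reach_refl.
rewrite (@step_keep _ _ _ _ _ _ (Return d) MoveN MoveN MoveL);
  rewrite /legal ?size_marks ?size_matrix_tape //; try lia.
  by apply: IH; lia.
by rewrite /delta nth_marks.
Qed.

(** A row costs [n] reads, one step at the right border and [n + 1] steps of [Return]. *)
Lemma run_rows x r : valid x -> r <= n ->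
  reach ((n - r) * (2 * n + 2))
    (cfg (Scan (acc_upto x (r * n))) matrix_tape (n + (r * n).+1) (marks x) r.+1 1)
    (cfg (Scan (acc_upto x (n * n))) matrix_tape (n + (n * n).+1) (marks x) n.+1 1).
Proof.
move=> xv; move m: (n - r) => m'; elim: m' r m => [|m IH] r mE rn.
  have -> : r = n by lia.
  exact: reach_refl.
have rn' : r < n by lia.
have rnn : r * n + n <= n * n by rewrite -mulSnr leq_mul2r rn' orbT.
have := run_row xv rn' (leq0n n); rewrite addn0 subn0 => row.
have ret : reach n.+2
    (cfg (Scan (acc_upto x (r * n + n))) matrix_tape (n + (r * n + n).+1) (marks x) r.+1 n.+1)
    (cfg (Scan (acc_upto x (r.+1 * n))) matrix_tape (n + (r.+1 * n).+1) (marks x) r.+2 1).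
  apply: reach_step.
  rewrite (@step_keep _ _ _ _ _ _ (Return (acc_upto x (r * n + n))) MoveN MoveR MoveL);
    rewrite /legal ?size_marks ?size_matrix_tape //; try lia; last first.
    by rewrite /delta nth_marks // nth_marks_end.
  by rewrite mulSnr; apply: run_return => /=; lia.
by apply: reach_le (reach_trans row (reach_trans ret (IH r.+1 _ _))) _; lia.
Qed.

(** The entry to be reset is in no cell, [Put] having failed to place it. For [j = ord0] there is no
    such entry and the tuple stays as it is. *)
Lemma run_begin j x y : (forall i, y i = if lift ord0 i == j then 0 else x i) ->
  (forall i, lift ord0 i == j -> n <= x i) ->
  tm_step (cfg (Begin j) matrix_tape n.+1 (marks x) 1 1) =
  cfg (Inc j) matrix_tape n.+1 (marks y) 1 1.
Proof.
move=> xy xj; rewrite (@step_both _ _ _ _ _ (Inc j)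
  (Some (inr ([set i | x i == 0] :|: [set i | lift ord0 i == j]))) MoveN (marks y)) //.
- by rewrite /delta nth_marks.
- by rewrite size_matrix_tape; lia.
apply: set_nth_marks => // [i|q i qn q0].
  by rewrite !inE xy; case: ifP => //=; rewrite ?orbT ?orbF.
by rewrite xy; case: ifP => // /xj; lia.
Qed.

(** Two rewinds of [N + 1] steps, a sweep of [2 * n * n + 2 * n] and a few single steps make at most
    [4 * N + 2], below [5 * N] as [n > 0]. *)
Lemma run_check x a p1 p2 : valid x -> a <= n * n + 1 -> p1 <= n -> p2 <= n ->
  if Q (acc_upto x (n * n))
  then halts (5 * N) (cfg (Home None) matrix_tape (n + a) (marks x) p1 p2) true
  else reach (5 * N) (cfg (Home None) matrix_tape (n + a) (marks x) p1 p2)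
                     (cfg (Inc ord0) matrix_tape n.+1 (marks x) 1 1).
Proof.
move=> xv an p1n p2n.
have home g a' p1' p2' : a' <= n * n + 1 -> p1' <= n -> p2' <= n ->
    reach N.+1 (cfg (Home g) matrix_tape (n + a') (marks x) p1' p2')
               (cfg (after_home g) matrix_tape n.+1 (marks x) 1 1).
  by move=> *; apply: run_home => //; rewrite /N; lia.
have scan : reach (N.+1 + n * (2 * n + 2))
    (cfg (Home None) matrix_tape (n + a) (marks x) p1 p2)
    (cfg (Scan (acc_upto x (n * n))) matrix_tape (n + (n * n).+1) (marks x) n.+1 1).
  apply: reach_trans (home _ _ _ _ an p1n p2n) _.
  have := run_rows xv (leq0n n); rewrite subn0 mul0n addn1 => rows.
  have -> : after_home None = Scan (acc_upto x 0) by congr Scan; apply/ffunP => i; rewrite !ffunE.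
  exact: rows.
have stepE : tm_step (cfg (Scan (acc_upto x (n * n))) matrix_tape (n + (n * n).+1) (marks x) n.+1 1)
    = cfg (if Q (acc_upto x (n * n)) then Halt true else Home (Some ord0))
          matrix_tape (n + (n * n).+1) (marks x) n 1.
  rewrite (@step_keep _ _ _ _ _ _
    (if Q (acc_upto x (n * n)) then Halt true else Home (Some ord0)) MoveN MoveL MoveN);
    rewrite /legal ?size_marks ?size_matrix_tape //; try lia.
  by rewrite /delta nth_marks_end.
case: ifP stepE => Qx stepE.
  have h : halts 1 (cfg (Scan (acc_upto x (n * n))) matrix_tape (n + (n * n).+1) (marks x) n.+1 1) true.
    exists (cfg (Halt true) matrix_tape (n + (n * n).+1) (marks x) n 1) => //.
    by apply: reach_step; rewrite stepE; apply: reach_refl.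
  by apply: halts_le (reach_halts scan h) _; rewrite /N; lia.
suff begin : reach N.+2 (cfg (Home (Some ord0)) matrix_tape (n + (n * n).+1) (marks x) n 1)
    (cfg (Inc ord0) matrix_tape n.+1 (marks x) 1 1).
  apply: reach_le (reach_trans scan (reach_step (b := N.+2) _)) _; first by rewrite stepE.
  by rewrite /N; lia.
rewrite -[N.+2]addn1; apply: reach_trans (home _ _ _ _ _ _ _) _; try lia.
apply: reach_step; rewrite (run_begin (y := x)); first exact: reach_refl.
  by move=> i; rewrite eq_sym (negbTE (neq_lift _ _)).
by move=> i; rewrite eq_sym (negbTE (neq_lift _ _)).
Qed.

(** * Increment and carry *)

(** The heads stop one cell past the old value: on the cell of the next value, or on the right
    border, which signals a carry. *)
Lemma run_inc (i : 'I_k) (j : 'I_k.+1) x : valid x -> val j = i ->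
  reach n.+1 (cfg (Inc j) matrix_tape n.+1 (marks x) 1 1)
    (cfg (Put i) matrix_tape n.+1 (marks (upd x i n)) (x i).+2 (x i).+2).
Proof.
move=> xv ji; have xi := xv i.
have insubE : insub (val j) = Some i by rewrite ji valK.
have find p : p <= x i -> reach (x i - p)
    (cfg (Inc j) matrix_tape n.+1 (marks x) p.+1 p.+1)
    (cfg (Inc j) matrix_tape n.+1 (marks x) (x i).+1 (x i).+1).
  move m: (x i - p) => m'; elim: m' p m => [|m IH] p mE px.
    have -> : p = x i by lia.
    exact: reach_refl.
  apply: reach_step; have pn : p < n by lia.
  rewrite (@step_both _ _ _ _ _ (Inc j) (cell x p) MoveR (marks x)).
  - by apply: IH; lia.
  - by [].
  - rewrite /delta nth_marks // insubE /= inE.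
    by have /negbTE -> : x i != p by lia.
  - by rewrite /legal size_marks; lia.
  - by rewrite size_matrix_tape; lia.
  - by rewrite -nth_marks // set_nth_id // size_marks; lia.
suff put : tm_step (cfg (Inc j) matrix_tape n.+1 (marks x) (x i).+1 (x i).+1) =
    cfg (Put i) matrix_tape n.+1 (marks (upd x i n)) (x i).+2 (x i).+2.
  apply: reach_le (reach_trans (find 0 (leq0n _)) (reach_step (b := 0) _)) _; last by lia.
  by rewrite put; apply: reach_refl.
rewrite (@step_both _ _ _ _ _ (Put i) (Some (inr ([set j | x j == x i] :\ i))) MoveR
  (marks (upd x i n))) //.
- by rewrite /delta nth_marks // insubE /= inE eqxx.
- by rewrite /legal size_marks; lia.
- by rewrite size_matrix_tape; lia.
- exact: marks_remove.
Qed.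

Lemma run_next (i : 'I_k) (j : 'I_k.+1) x : valid x -> val j = i -> (x i).+1 < n ->
  reach (5 * N) (cfg (Inc j) matrix_tape n.+1 (marks x) 1 1)
    (cfg (Home None) matrix_tape n.+1 (marks (upd x i (x i).+1)) (x i).+2 (x i).+2).
Proof.
move=> xv ji xi.
apply: reach_le (reach_trans (run_inc xv ji) (reach_step (b := 0) _)) _; last by rewrite /N; lia.
rewrite (@step_both _ _ _ _ _ (Home None)
  (Some (inr (i |: [set j | upd x i n j == (x i).+1]))) MoveN (marks (upd x i (x i).+1))) //.
- exact: reach_refl.
- by rewrite /delta nth_marks.
- by rewrite /legal size_marks; lia.
- by rewrite size_matrix_tape; lia.
rewrite marks_add //; last by rewrite ffunE eqxx.
by congr marks; apply/ffunP => l; rewrite !ffunE; case: (l == i).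
Qed.

Lemma run_carry (i : 'I_k) (j : 'I_k.+1) x : valid x -> val j = i -> (x i).+1 = n ->
  reach (5 * N) (cfg (Inc j) matrix_tape n.+1 (marks x) 1 1)
    (cfg (Inc (lift ord0 i)) matrix_tape n.+1 (marks (upd x i 0)) 1 1).
Proof.
move=> xv ji xi.
have put : reach N.+2
    (cfg (Put i) matrix_tape n.+1 (marks (upd x i n)) (x i).+2 (x i).+2)
    (cfg (Begin (lift ord0 i)) matrix_tape n.+1 (marks (upd x i n)) 1 1).
  apply: reach_step; rewrite xi.
  rewrite (@step_keep _ _ _ _ _ _ (Home (Some (lift ord0 i))) MoveN MoveL MoveL);
    rewrite /legal ?size_marks ?size_matrix_tape //; try lia; last by rewrite /delta nth_marks_end.
  have := @run_home (Some (lift ord0 i)) (upd x i n) N 1 n n.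
  by rewrite (addn1 n); apply; rewrite /N; lia.
apply: reach_le (reach_trans (run_inc xv ji) (reach_trans put (reach_step (b := 0) _))) _;
  last by rewrite /N; lia.
rewrite (run_begin (y := upd x i 0)); first exact: reach_refl.
  by move=> l; rewrite !ffunE (inj_eq lift_inj); case: ifP.
by move=> l; rewrite (inj_eq lift_inj) ffunE => ->.
Qed.

(** * Enumeration of all tuples *)

Fixpoint search_time (m W : nat) : nat :=
  if m is m'.+1 then W * (search_time m' W + 5 * W) else 5 * W.

(* The machine behaves as [k] nested loops: starting with the entries below [m]
   equal to 0, it runs through all values of these entries before it reaches
   [Inc m], where they are 0 again. *)
Lemma run_search m x a p1 p2 : m <= k -> valid x -> (forall i : 'I_k, i < m -> x i = 0) ->
  a <= n * n + 1 -> p1 <= n -> p2 <= n ->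
  (exists2 y, valid y /\ Q (acc_upto y (n * n)) &
     halts (search_time m N) (cfg (Home None) matrix_tape (n + a) (marks x) p1 p2) true)
  \/ ((forall y, valid y -> (forall i : 'I_k, m <= i -> y i = x i) -> ~~ Q (acc_upto y (n * n))) /\
     forall j : 'I_k.+1, val j = m ->
     reach (search_time m N) (cfg (Home None) matrix_tape (n + a) (marks x) p1 p2)
       (cfg (Inc j) matrix_tape n.+1 (marks x) 1 1)).
Proof.
elim: m x a p1 p2 => [|m IH] x a p1 p2 mk xv x0 an p1n p2n.
  have := run_check xv an p1n p2n; case: ifP => Qx run; [left | right].
    by exists x.
  split=> [y yv yx|j j0].
    by have -> : y = x; [apply/ffunP => i; apply: yx | rewrite Qx].
  by have -> : j = ord0 by apply: val_inj.
pose i := Ordinal mk; pose j0 : 'I_k.+1 := Ordinal (ltnW mk : m < k.+1).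
pose B u := u * (search_time m N + 5 * N).
(* [u] bounds the number of values left for entry [m], the current one included; each costs a search
   over the lower entries and an increment or carry. *)
suff loop u : forall x a p1 p2, valid x -> (forall l : 'I_k, l < m -> x l = 0) ->
    a <= n * n + 1 -> p1 <= n -> p2 <= n -> n - x i <= u ->
  (exists2 y, valid y /\ Q (acc_upto y (n * n)) &
     halts (B u) (cfg (Home None) matrix_tape (n + a) (marks x) p1 p2) true)
  \/ ((forall y, valid y -> x i <= y i -> (forall l : 'I_k, m < l -> y l = x l) ->
        ~~ Q (acc_upto y (n * n))) /\
     reach (B u) (cfg (Home None) matrix_tape (n + a) (marks x) p1 p2)
       (cfg (Inc (lift ord0 i)) matrix_tape n.+1 (marks (upd x i 0)) 1 1)).
  have xi0 : x i = 0 by apply: x0 => /=.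
  have nN : n - x i <= N by rewrite /N; lia.
  have x0' (l : 'I_k) : l < m -> x l = 0 by move=> lm; apply: x0; apply: ltnW.
  (* Bounding the number of turns by [N] instead of [n] makes the time a function of the input
     length alone. *)
  case: (loop N x a p1 p2 xv x0' an p1n p2n nN) => [found|[none run]]; [by left | right].
  split=> [y yv yx|j jm]; first by apply: none => //; rewrite xi0.
  have -> : j = lift ord0 i by apply: val_inj; rewrite jm.
  have xE : upd x i 0 = x by apply/ffunP => l; rewrite ffunE; case: eqP => // ->.
  by rewrite -{2}xE.
elim: u => [|u IHu] {x0 xv an p1n p2n a p1 p2}x a p1 p2 xv x0 an p1n p2n xu.
  by have := xv i; lia.
case: (IH x a p1 p2 (ltnW mk) xv x0 an p1n p2n) => [[y yQ run]|[none run]].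
  left; exists y => //; apply: halts_le run _; rewrite /B mulSn; lia.
have {}run := run j0 erefl.
have [xi|xi] := ltnP (x i).+1 n; last first.
  have xi' : (x i).+1 = n by have := xv i; lia.
  right; split=> [y yv xy yx|].
    apply: none => // l lm; case: (ltngtP m l) => ml; first exact: yx.
      by lia.
    have -> : l = i by apply: val_inj.
    by have := yv i; lia.
  apply: reach_le (reach_trans run (run_carry xv _ xi')) _ => //.
  by rewrite /B mulSn; lia.
pose x' := upd x i (x i).+1.
have x'v : valid x' by move=> l; rewrite ffunE; case: ifP.
have x'0 (l : 'I_k) : l < m -> x' l = 0.
  move=> lm; rewrite ffunE; case: eqP => [li|_]; last exact: x0.
  by move: lm; rewrite li /= ltnn.
have step : reach (search_time m N + 5 * N)
    (cfg (Home None) matrix_tape (n + a) (marks x) p1 p2)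
    (cfg (Home None) matrix_tape (n + 1) (marks x') (x i).+2 (x i).+2).
  by rewrite addn1; apply: reach_trans run (run_next xv _ xi).
have x'i : x' i = (x i).+1 by rewrite ffunE eqxx.
case: (IHu x' 1 (x i).+2 (x i).+2 x'v x'0) => //; try lia.
  case=> y yQ run'; left; exists y => //.
  by rewrite /B mulSn; apply: reach_halts step run'.
case=> none' run'; right; split=> [y yv xy yx|].
  (* A tuple with the current value of entry [m] was covered by the inner search, one with a larger
     value by the remaining turns. *)
  have [yi|yi] := eqVneq (y i) (x i).
    apply: none => // l lm; case: (ltngtP m l) => ml; first exact: yx.
      by lia.
    by have -> : l = i by apply: val_inj.
  apply: none' => //; first by rewrite x'i; lia.
  move=> l ml; rewrite ffunE; case: eqP => [li|_]; last exact: yx.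
  by move: ml; rewrite li /= ltnn.
have -> : upd x i 0 = upd x' i 0.
  by apply/ffunP => l; rewrite !ffunE; case: ifP.
by rewrite /B mulSn; apply: reach_trans step run'.
Qed.

(** * Setup and the complete run *)

Let w := nseq n true ++ false :: bits.
Let x0 : {ffun 'I_k -> nat} := [ffun=> 0].
Let input : seq sym := [seq Some (inl b) | b <- w].
Let marked : seq sym := nseq n sharp ++ mark :: [seq Some (inl b) | b <- bits].

Lemma size_input : size input = n + n * n + 1.
Proof. by rewrite size_map size_cat size_nseq /= size_bits; lia. Qed.

Lemma run_copy p : p <= n ->
  reach (n - p) (cfg (Copy (p == 0)) input p (sharp :: mkseq (cell x0) p) p.+1 p.+1)
    (cfg (Copy false) input n (sharp :: mkseq (cell x0) n) n.+1 n.+1).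
Proof.
move m: (n - p) => m'; elim: m' p m => [|m IH] p mE pn.
  have -> : p = n by lia.
  by rewrite (gtn_eqF n_gt0); apply: reach_refl.
have pn' : p < n by lia.
have nthE : nth None input p = sharp.
  by rewrite (nth_map false) ?size_cat ?size_nseq ?nth_cat ?size_nseq ?pn' ?nth_nseq ?pn' //=; lia.
have cellE : Some (inr (if p == 0 then [set: 'I_k] else set0)) = cell x0 p.
  congr (Some (inr _)); apply/setP => i.
  by rewrite [RHS]inE ffunE; case: (p) => [|p']; rewrite !inE.
apply: reach_step.
have setE : set_nth None (sharp :: mkseq (cell x0) p) p.+1 (cell x0 p) =
    sharp :: mkseq (cell x0) p.+1.
  by rewrite set_nthE /= size_mkseq ltnn /ncons subnn /= mkseqS cats1.
rewrite (@step_cfg _ _ _ _ _ _ (Copy false) sharp MoveR (cell x0 p) MoveR (cell x0 p) MoveR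
  (sharp :: mkseq (cell x0) p.+1)) //.
- have ps : p < size input by rewrite size_input; lia.
  by have := set_nth_id None ps; rewrite nthE => ->; apply: (IH p.+1); lia.
- by rewrite /delta nthE cellE.
- by rewrite /legal size_input; lia.
- by rewrite /legal /= size_mkseq; lia.
- by rewrite /legal /= size_mkseq; lia.
Qed.

Lemma run_skip q : q <= n * n ->
  reach (n * n - q) (cfg Skip marked (n + q.+1) (marks x0) n n)
    (cfg Skip marked (n + (n * n).+1) (marks x0) n n).
Proof.
move m: (n * n - q) => m'; elim: m' q m => [|m IH] q mE qn.
  have -> : q = n * n by lia.
  exact: reach_refl.
have qn' : q < n * n by lia.
have sz : size marked = n + n * n + 1.
  by rewrite size_cat size_nseq /= size_map size_bits; lia.
have nthE : nth None marked (n + q.+1) = Some (inl (nth false bits q)).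
  rewrite nth_cat size_nseq ltnNge leq_addr /= addKn /=.
  by rewrite (nth_map false) ?size_bits.
apply: reach_step.
rewrite (@step_keep _ _ _ _ _ _ Skip MoveR MoveN MoveN);
  rewrite /legal ?size_marks ?sz //; try lia.
  by rewrite /= -addnS; apply: IH; lia.
by rewrite /delta nthE.
Qed.

Lemma run_setup : reach N.+2 (tm_init machine w)
  (cfg (Home None) matrix_tape (n + n * n) (marks x0) n n).
Proof.
have initE : tm_init machine w = cfg Start input 0 [::] 0 0.
  congr pair; apply/ffunP => i; rewrite !ffunE /tri /tape_at !take0 !drop0.
  by case: i => -[|[|[|//]]].
have start : tm_step (cfg Start input 0 [::] 0 0) =
    cfg (Copy (0 == 0)) input 0 (sharp :: mkseq (cell x0) 0) 1 1.
  by rewrite (@step_both _ _ _ _ _ (Copy true) sharp MoveR [:: sharp]) // size_input; lia.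
have inputn : nth None input n = Some (inl false).
  by rewrite (nth_map false) ?size_cat ?size_nseq ?nth_cat ?size_nseq ?ltnn ?subnn //=; lia.
have sz : size marked = n + n * n + 1.
  by rewrite size_cat size_nseq /= size_map size_bits; lia.
have finish : tm_step (cfg (Copy false) input n (sharp :: mkseq (cell x0) n) n.+1 n.+1)
    = cfg Skip marked (n + 1) (marks x0) n n.
  have setE : set_nth None (sharp :: mkseq (cell x0) n) n.+1 sharp = marks x0.
    by rewrite set_nthE /= size_mkseq ltnn /ncons subnn /= cats1.
  rewrite (@step_cfg _ _ _ _ _ _ Skip mark MoveR sharp MoveL sharp MoveL (marks x0)) //.
  - rewrite addn1; congr cfg; rewrite set_nthE size_input.
    have -> : n < n + n * n + 1 by lia.
    rewrite /input /w map_cat map_nseq take_size_cat ?size_nseq //.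
    by rewrite drop_cat size_nseq ltnNge leqnSn /= subSnn drop1.
  - by rewrite /delta inputn.
  - by rewrite /legal size_input; lia.
  - by rewrite /legal /= size_mkseq; lia.
  - by rewrite /legal /= size_mkseq; lia.
have turn : tm_step (cfg Skip marked (n + (n * n).+1) (marks x0) n n) =
    cfg (Home None) matrix_tape (n + n * n) (marks x0) n n.
  have szE : n + (n * n).+1 = size marked by rewrite sz; lia.
  rewrite (@step_cfg _ _ _ _ _ _ (Home None) None MoveL
    (nth None (marks x0) n) MoveN (nth None (marks x0) n) MoveN (marks x0)) //.
  - rewrite /= addnS; congr cfg; rewrite -addnS szE set_nthE ltnn /ncons subnn /=.
    by rewrite /matrix_tape /marked -catA.
  - by rewrite /delta szE nth_default.
  - by rewrite /legal sz; lia.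
  - by rewrite /legal size_marks; lia.
  - by rewrite /legal size_marks; lia.
  - by rewrite set_nth_id // size_marks; lia.
  - by rewrite set_nth_id // size_marks; lia.
have h1 : reach 1 (tm_init machine w)
    (cfg (Copy (0 == 0)) input 0 (sharp :: mkseq (cell x0) 0) 1 1).
  by apply: reach_step; rewrite initE start; apply: reach_refl.
have h2 : reach 1 (cfg (Copy false) input n (sharp :: mkseq (cell x0) n) n.+1 n.+1)
    (cfg Skip marked (n + 1) (marks x0) n n).
  by apply: reach_step; rewrite finish; apply: reach_refl.
have h3 : reach 1 (cfg Skip marked (n + (n * n).+1) (marks x0) n n)
    (cfg (Home None) matrix_tape (n + n * n) (marks x0) n n).
  by apply: reach_step; rewrite turn; apply: reach_refl.
apply: reach_le (reach_trans h1 (reach_trans (run_copy (leq0n n)) (reach_trans h2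
  (reach_trans (run_skip (leq0n _)) h3)))) _.
by rewrite /N; lia.
Qed.

(** Setup, search, and the step that rejects on a carry out of the last entry. *)
Definition total_time W := W.+2 + (search_time k W + 1).

Lemma run_machine : exists2 b, halts (total_time N) (tm_init machine w) b &
  b <-> exists2 y, valid y & Q (acc_upto y (n * n)).
Proof.
have xv : valid x0 by move=> i; rewrite ffunE.
have xz (i : 'I_k) : i < k -> x0 i = 0 by rewrite ffunE.
case: (run_search (leqnn k) xv xz (leq_addr 1 _) (leqnn n) (leqnn n)).
  case=> y [yv Qy] run; exists true; last by split=> // _; exists y.
  by apply: halts_le (reach_halts run_setup run) _; rewrite /total_time; lia.
case=> none /(_ ord_max erefl) run; exists false; last first.
  split=> // -[y yv Qy]; have := none y yv; rewrite Qy; apply=> i.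
  by rewrite leqNgt ltn_ord.
apply: reach_halts run_setup (reach_halts run _).
exists (cfg (Halt false) matrix_tape n.+1 (marks x0) 1 1) => //.
apply: reach_step; rewrite (@step_keep _ _ _ _ _ _ (Halt false) MoveN MoveN MoveN);
  rewrite /legal ?size_marks ?size_matrix_tape //; try lia; first exact: reach_refl.
by rewrite /delta /= insubF // ltnn.
Qed.

End Run.

(** Without vertices the first symbol is already the separator. Only the empty tuple, for [k = 0],
    exists then, and [acc0] is its pattern. *)
Lemma run_empty : halts (total_time 1) (tm_init machine [:: false]) ((k == 0) && Q acc0).
Proof.
have initE : tm_init machine [:: false] = cfg Start [:: Some (inl false)] 0 [::] 0 0.
  congr pair; apply/ffunP => i; rewrite !ffunE /tri /tape_at.
  by case: i => -[|[|[|//]]].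
have start : tm_step (cfg Start [:: Some (inl false)] 0 [::] 0 0) =
    cfg (Copy true) [:: Some (inl false)] 0 [:: sharp] 1 1.
  by rewrite (@step_both _ _ _ _ _ (Copy true) sharp MoveR [:: sharp]).
exists (cfg (Halt ((k == 0) && Q acc0)) [:: mark] 1 [:: sharp; sharp] 0 0) => //.
apply: (@reach_le 2); last by rewrite /total_time; lia.
rewrite initE; apply: reach_step; rewrite start; apply: reach_step.
rewrite (@step_cfg _ _ _ _ _ _ (Halt ((k == 0) && Q acc0)) mark MoveR sharp MoveL sharp MoveL
  [:: sharp; sharp]) //.
exact: reach_refl.
Qed.

End Machine.

(** * From the machine to polynomial time *)

Import GRing.Theory.

Lemma total_time_poly k : exists p : {poly nat}, forall W, (p.[W])%R = total_time k W.
Proof.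
have st m : exists p : {poly nat}, forall W, (p.[W])%R = search_time m W.
  elim: m => [|m [p pE]]; first by exists (5%:P * 'X)%R => W; rewrite hornerCM hornerX.
  exists ('X * (p + 5%:P * 'X))%R => W.
  by rewrite hornerM hornerD hornerCM hornerX pE.
have [p pE] := st k; exists ('X + 2%:P + (p + 1%:P))%R => W.
by rewrite !hornerD !hornerC hornerX pE /total_time !natrDE addn2.
Qed.

Lemma nth_allpairs (S T R : Type) (f : S -> T -> R) x0 y0 z0 s t r c :
  r < size s -> c < size t ->
  nth z0 [seq f x y | x <- s, y <- t] (r * size t + c) = f (nth x0 s r) (nth y0 t c).
Proof.
move=> rs ct; elim: s r rs => // x s IH [|r] rs; rewrite allpairs_cons nth_cat size_map.
  by rewrite mul0n add0n ct (nth_map y0).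
by rewrite mulSn -addnA ltnNge leq_addr /= addKn IH.
Qed.

Lemma acc_upto_pattern k (G : sgraph) (v : 'I_k -> G) (y : {ffun 'I_k -> nat}) :
  (forall i, y i = enum_rank (v i)) ->
  acc_upto #|G| [seq adj x y | x <- enum G, y <- enum G] y (#|G| * #|G|) = pattern v.
Proof.
move=> yE; apply/ffunP => -[i j]; rewrite !ffunE /= !yE.
have rn (x : G) : enum_rank x < #|G| by apply: ltn_ord.
have -> : enum_rank (v i) * #|G| + enum_rank (v j) < #|G| * #|G|.
  apply: (@leq_trans ((enum_rank (v i)).+1 * #|G|)); first by rewrite mulSnr ltn_add2l.
  by rewrite leq_mul2r rn orbT.
have := @nth_allpairs _ _ _ (@adj G) (v i) (v i) false (enum G) (enum G)
  (enum_rank (v i)) (enum_rank (v j)).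
rewrite -cardE !nth_enum_rank => ->; rewrite ?rn //.
by rewrite (inj_eq val_inj) (inj_eq enum_rank_inj).
Qed.

(** [Q] is only applied to values of a finite type held in the state, so it is part of the
    transition table and takes no time. Tuples of vertices and of numbers correspond by rank in
    [enum G], the order of the matrix. *)
Lemma pattern_ptime k (Q : pred {ffun 'I_k * 'I_k -> bool * bool}) (promise : sgraph -> Prop) :
  ptime_solvable graph_code promise (fun G => exists v : 'I_k -> G, Q (pattern v)).
Proof.
have [p pE] := total_time_poly k; exists (machine Q), p => G _; rewrite pE.
set bits := [seq adj x y | x <- enum G, y <- enum G].
have size_bits : size bits = #|G| * #|G| by rewrite size_allpairs -cardE.
have sizeE : size (graph_code G) = #|G| * #|G| + #|G| + 1.
  by rewrite size_cat size_nseq /= size_bits addnS addn1 addnC.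
case: (posnP #|G|) => [G0|G_gt0].
  exists ((k == 0) && Q (acc0 k)); have noG (x : G) : False.
    by have := card0_eq G0 x.
  split.
    have -> : graph_code G = [:: false].
      by rewrite /graph_code G0 (size0nil (s := enum G)) // -cardE.
    exact/halts_answer/run_empty.
  split=> [/andP [/eqP k0 Q0]|[v Qv]].
    have noI (i : 'I_k) : False by case: i => i; rewrite k0.
    exists (fun i => False_rect _ (noI i)).
    by rewrite (_ : pattern _ = acc0 k) //; apply/ffunP => -[i]; case: (noI i).
  have noI (i : 'I_k) : False by apply: noG (v i).
  rewrite (_ : acc0 k = pattern v) ?Qv ?andbT; last by apply/ffunP => -[i]; case: (noI i).
  by case: (posnP k) => // k0; case: (noI (Ordinal k0)).
have [b run bE] := run_machine Q G_gt0 size_bits.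
exists b; split; first by rewrite sizeE; apply: halts_answer.
rewrite -[b = true]/(is_true b) bE; split.
  case=> y yv; rewrite (acc_upto_pattern (v := fun i => enum_val (Ordinal (yv i)))) => [Qv|i].
    by exists (fun i => enum_val (Ordinal (yv i))).
  by rewrite enum_valK.
case=> v Qv; exists [ffun i => nat_of_ord (enum_rank (v i))].
  by move=> i; rewrite ffunE.
by rewrite (acc_upto_pattern (v := v)) // => i; rewrite ffunE.
Qed.

Theorem theorem1p4 (H : sgraph) (t : nat) (t_gt0 : 0 < t) :
  ptime_solvable graph_code (path_free t) (fun G : sgraph => induced_minor H G).
Proof.
pose I : finType := (H * slot H t)%type.
(* The machine numbers its entries by an ordinal, so [Q] renames them by slots before testing the
   table. *)
pose Q (d : {ffun 'I_#|I| * 'I_#|I| -> bool * bool}) : bool :=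
  good_pattern [ffun ab : I * I => d (enum_rank ab.1, enum_rank ab.2)].
have [M [p Mp]] := pattern_ptime Q (path_free t).
exists M, p => G Ptf; have [b [run bE]] := Mp G Ptf; exists b; split=> //.
rewrite bE; split=> [[v Qv]|/(good_pattern_complete t_gt0 Ptf) [x Qx]].
  apply: (good_pattern_sound t_gt0 (x := fun a : I => v (enum_rank a))).
  suff -> : pattern (fun a : I => v (enum_rank a)) =
      [ffun ab => pattern v (enum_rank ab.1, enum_rank ab.2)] by [].
  by apply/ffunP => ab; rewrite !ffunE.
exists (fun i => x (enum_val i)); rewrite /Q.
suff -> : [ffun ab => pattern (fun i => x (enum_val i)) (enum_rank ab.1, enum_rank ab.2)]
    = pattern x by [].
by apply/ffunP => ab; rewrite !ffunE /= !enum_rankK.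
Qed.
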